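(* Let $H$ be a Hopf algebra with invertible antipode $S$ over a field $k$ of characteristic $0$, let $i\in\mathbb{Z}$ and let $M$ be a $YD_{i-1}$-module. Then the following diagram of isomorphisms commutes in $YD_{i+1}\text{-ctrmd}$: the map $\widehat{\sigma_M}:\widehat{M}\to\widehat{{}_{S^{2i}}M^{S^{-2i}}}$ equals the composite $$\widehat{M}\xrightarrow{\ \sigma_{\widehat{M}}\ }{}_{S^{2i}}\widehat{M}^{S^{-2i}}\xrightarrow{\ f\mapsto f(S^{2i}(-))\ }\widehat{{}_{S^{2i}}M^{S^{-2i}}}.$$
   Context: Sweedler notation: $\Delta(h)=h^1\otimes h^2$; a right coaction is $m\mapsto m_0\otimes m_1$; $f(a-b)$ means $x\mapsto f(axb)$; $\mathrm{Hom}$ denotes $k$-linear maps and $\mathrm{Hom}(-,-)^H$ right $H$-comodule maps. A right $H$-contramodule is a vector space $N$ with linear $\alpha:\mathrm{Hom}(H,N)\to N$ such that $\alpha(x\mapsto\alpha(h\mapsto f(x\otimes h)))=\alpha(h\mapsto f(h^1\otimes h^2))$ for $f\in\mathrm{Hom}(H\otimes H,N)$ and $\alpha(h\mapsto\epsilon(h)n)=n$. For $j\in\mathbb{Z}$, a $YD_j$-module is a left $H$-module and right $H$-comodule $M$ with $(hm)_0\otimes(hm)_1=h^2m_0\otimes h^3m_1S^{-1-2j}(h^1)$. A $YD_j$-contramodule is a left $H$-module and right $H$-contramodule $N$ with $h\alpha(f)=\alpha(h^2f(S(h^3)-S^{2-2j}(h^1)))$. Morphisms preserve both structures. ${}_{S^{2i}}M^{S^{-2i}}$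 is the same vector space with $H$-action modified to $h\cdot m=S^{2i}(h)m$ and coaction modified to $m_0\otimes S^{-2i}(m_1)$ (module case), respectively contraaction modified to $f\mapsto\alpha(f\circ S^{-2i})$ (contramodule case). The functor $\widehat{(-)}:YD_{i-1}\text{-mod}\to YD_{i+1}\text{-ctrmd}$ sends $M$ to $\widehat{M}=\mathrm{Hom}(H,M)^H$ with action $h\cdot f=h^2f(S(h^3)-S^{-2i}(h^1))$ and contraaction $(\alpha\theta)(h)=\theta_{h^1}(h^2)$ for $\theta:h\mapsto\theta_h$; on morphisms it is composition. $\sigma_M:M\to{}_{S^{2i}}M^{S^{-2i}}$, $m\mapsto S^{2i}(m_1)m_0$, is an isomorphism in $YD_{i-1}\text{-mod}$; for a $YD_{i+1}$-contramodule $N$, $\sigma_N:N\to{}_{S^{2i}}N^{S^{-2i}}$, $n\mapsto\alpha(h\mapsto hn)$, is an isomorphism in $YD_{i+1}\text{-ctrmd}$. *)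

(* Defs.v *)
From HB Require Import structures.
From mathcomp Require Import all_boot all_algebra.
From mathcomp Require Import boolp.
Set Implicit Arguments.
Unset Strict Implicit.
Unset Printing Implicit Defensive.
Import GRing.Theory.
Local Open Scope quotient_scope.
Local Open Scope ring_scope.


Definition mklin (k : fieldType) (V W : lmodType k) (f : V -> W)
    (hf : linear f) : {linear V -> W} :=
  HB.pack f (GRing.isLinear.Build k V W *:%R f hf).

Section Hom.
Variables (k : fieldType) (V W : lmodType k).
Implicit Types f g : {linear V -> W}.

Lemma linP f g : f =1 g -> f = g.
Proof.
case: f g => [f [[a] [b]]] [g [[c] [d]]] /= /funext e.
case: _ / e in c d *.
by rewrite (Prop_irrelevance a c) (Prop_irrelevance b d).
Qed.

HB.instance Definition _ := gen_eqMixin {linear V -> W}.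
HB.instance Definition _ := gen_choiceMixin {linear V -> W}.

Lemma hom_zero_subproof : linear (fun _ : V => 0 : W).
Proof. by move=> a x y; rewrite scaler0 addr0. Qed.
Lemma hom_opp_subproof f : linear (fun x => - f x).
Proof. by move=> a x y; rewrite linearP opprD scalerN. Qed.
Lemma hom_add_subproof f g : linear (fun x => f x + g x).
Proof. by move=> a x y; rewrite !linearP scalerDr addrACA. Qed.
Lemma hom_scale_subproof a f : linear (fun x => a *: f x).
Proof. by move=> b x y; rewrite linearP scalerDr !scalerA mulrC. Qed.

Definition hom_zero : {linear V -> W} := mklin hom_zero_subproof.
Definition hom_opp f := mklin (hom_opp_subproof f).
Definition hom_add f g := mklin (hom_add_subproof f g).
Definition hom_scale a f := mklin (hom_scale_subproof a f).

Lemma hom_addA : associative hom_add.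
Proof. by move=> f g h; apply: linP => x; apply: addrA. Qed.
Lemma hom_addC : commutative hom_add.
Proof. by move=> f g; apply: linP => x; apply: addrC. Qed.
Lemma hom_add0 : left_id hom_zero hom_add.
Proof. by move=> f; apply: linP => x; apply: add0r. Qed.
Lemma hom_addN : left_inverse hom_zero hom_opp hom_add.
Proof. by move=> f; apply: linP => x; apply: addNr. Qed.
HB.instance Definition _ :=
  GRing.isZmodule.Build {linear V -> W} hom_addA hom_addC hom_add0 hom_addN.

Lemma hom_scaleA a b f : hom_scale a (hom_scale b f) = hom_scale (a * b) f.
Proof. by apply: linP => x; apply: scalerA. Qed.
Lemma hom_scale1 : left_id 1 hom_scale.
Proof. by move=> f; apply: linP => x; apply: scale1r. Qed.
Lemma hom_scaleDr : right_distributive hom_scale +%R.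
Proof. by move=> a f g; apply: linP => x; apply: scalerDr. Qed.
Lemma hom_scaleDl f : {morph hom_scale^~ f : a b / a + b}.
Proof. by move=> a b; apply: linP => x; apply: scalerDl. Qed.
HB.instance Definition _ := GRing.Zmodule_isLmodule.Build k {linear V -> W}
  hom_scaleA hom_scale1 hom_scaleDr hom_scaleDl.

Lemma hom_addE f g x : (f + g) x = f x + g x. Proof. by []. Qed.
Lemma hom_scaleE a f x : (a *: f) x = a *: f x. Proof. by []. Qed.
End Hom.

Section Tensor.
Variables (k : fieldType) (V W : lmodType k).

Definition bilin (U : lmodType k) (B : V -> W -> U) : Prop :=
  (forall w, linear (B^~ w)) /\ (forall v, linear (B v)).

Definition tsumseq (U : lmodType k) (B : V -> W -> U) (s : seq (V * W)) : U :=
  \sum_(p <- s) B p.1 p.2.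

Definition teq (s t : seq (V * W)) : bool :=
  `[< forall (U : lmodType k) (B : V -> W -> U),
        bilin B -> tsumseq B s = tsumseq B t >].

Lemma teq_refl : reflexive teq. Proof. by move=> s; apply/asboolP. Qed.
Lemma teq_sym : symmetric teq.
Proof. by move=> s t; apply/asboolP/asboolP => e U B hB; rewrite e. Qed.
Lemma teq_trans : transitive teq.
Proof. 
by move=> s t u /asboolP e /asboolP e'; apply/asboolP => U B hB; rewrite e ?e'.
Qed.
Canonical teq_equiv := EquivRel teq teq_refl teq_sym teq_trans.

Definition tensor := {eq_quot teq}.
HB.instance Definition _ := Choice.on tensor.
HB.instance Definition _ := EqQuotient.on tensor.

Definition tsum (U : lmodType k) (B : V -> W -> U) (t : tensor) : U :=
  tsumseq B (repr t).

Lemma tsum_pi (U : lmodType k) (B : V -> W -> U) s : bilin B -> 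
  tsum B (\pi_tensor s) = tsumseq B s.
Proof.
move=> hB; rewrite /tsum.
by have /eqmodP/asboolP/(_ U B hB) := reprK (\pi_tensor s).
Qed.

Lemma tensorP (s t : tensor) :
  (forall (U : lmodType k) (B : V -> W -> U), bilin B -> tsum B s = tsum B t) ->
  s = t.
Proof.
rewrite -(reprK s) -(reprK t) => e; apply/eqmodP/asboolP => U B hB.
by rewrite -!tsum_pi ?e.
Qed.

Definition tensor_zero : tensor := \pi_tensor [::].
Definition tensor_add (s t : tensor) : tensor := \pi_tensor (repr s ++ repr t).
Definition tensor_scale (a : k) (s : tensor) : tensor :=
  \pi_tensor [seq (a *: p.1, p.2) | p <- repr s].
Definition tensor_opp (s : tensor) : tensor := tensor_scale (-1) s.

Section T.
Variables (U : lmodType k) (B : V -> W -> U).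
Hypothesis hB : bilin B.
Lemma tsum_zero : tsum B tensor_zero = 0.
Proof. by rewrite tsum_pi // /tsumseq big_nil. Qed.
Lemma tsum_add s t : tsum B (tensor_add s t) = tsum B s + tsum B t.
Proof. by rewrite tsum_pi // /tsumseq big_cat. Qed.
Lemma tsum_scale a s : tsum B (tensor_scale a s) = a *: tsum B s.
Proof.
rewrite tsum_pi // /tsumseq big_map /= scaler_sumr; apply: eq_bigr => p _ /=.
have h : linear (B^~ p.2) := hB.1 _.
by rewrite -[B (_ *: _) _]/(mklin h (a *: p.1)) linearZ.
Qed.
End T.

Lemma tensor_addA : associative tensor_add.
Proof. by move=> s t u; apply: tensorP => U B h; rewrite !tsum_add // addrA. Qed.
Lemma tensor_addC : commutative tensor_add.
Proof. by move=> s t; apply: tensorP => U B h; rewrite !tsum_add // addrC. Qed.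
Lemma tensor_add0 : left_id tensor_zero tensor_add.
Proof. by move=> s; apply: tensorP => U B h; rewrite !tsum_add // tsum_zero ?add0r. Qed.
Lemma tensor_addN : left_inverse tensor_zero tensor_opp tensor_add.
Proof.
move=> s; apply: tensorP => U B h.
by rewrite !tsum_add // tsum_zero // tsum_scale // scaleN1r addNr.
Qed.
HB.instance Definition _ := GRing.isZmodule.Build tensor tensor_addA tensor_addC tensor_add0 tensor_addN.

Lemma tensor_scaleA a b s : tensor_scale a (tensor_scale b s) = tensor_scale (a * b) s.
Proof. by apply: tensorP => U B h; rewrite !tsum_scale // scalerA. Qed.
Lemma tensor_scale1 : left_id 1 tensor_scale.
Proof. by move=> s; apply: tensorP => U B h; rewrite !tsum_scale // scale1r. Qed.
Lemma tensor_scaleDr : right_distributive tensor_scale +%R.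
Proof.
move=> a s t; apply: tensorP => U B h.
by rewrite tsum_scale // !tsum_add // !tsum_scale // scalerDr.
Qed.
Lemma tensor_scaleDl s : {morph tensor_scale^~ s : a b / a + b}.
Proof.
move=> a b; apply: tensorP => U B h.
by rewrite tsum_scale // !tsum_add // !tsum_scale // scalerDl.
Qed.
HB.instance Definition _ := GRing.Zmodule_isLmodule.Build k tensor
  tensor_scaleA tensor_scale1 tensor_scaleDr tensor_scaleDl.

Definition tens (v : V) (w : W) : tensor := \pi_tensor [:: (v, w)].

Lemma tsum_linear (U : lmodType k) (B : V -> W -> U) : bilin B -> linear (tsum B).
Proof. by move=> h a s t; rewrite tsum_add // tsum_scale. Qed.

Lemma tsumE (U : lmodType k) (B : V -> W -> U) v w :
  bilin B -> tsum B (tens v w) = B v w.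
Proof. by move=> h; rewrite tsum_pi // /tsumseq big_seq1. Qed.

Lemma tens_bilin : bilin tens.
Proof.
split=> [w|v] a x y; apply: tensorP => U B h; rewrite tsum_linear // !tsumE //;
 by rewrite ?h.1 ?h.2.
Qed.

Lemma tsum_tens t : tsum tens t = t.
Proof.
apply: tensorP => U B h.
have l := tsum_linear h.
rewrite -[LHS]/(mklin l _) {1}/tsum /tsumseq linear_sum.
by apply: eq_bigr => p _; apply: tsumE.
Qed.

End Tensor.


Reserved Notation "v ⊗ w" (at level 45, left associativity).
Reserved Notation "\sw_ ( a , b <- t ) F" (at level 46, F at level 46, a name, b name, t at level 99,
  format "\sw_ ( a ,  b  <-  t )  F").
Notation "v ⊗ w" := (tens v w) : ring_scope.
Notation "\sw_ ( a , b <- t ) F" := (tsum (fun a b => F) t) : ring_scope.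

Section LinTools.
Variable k : fieldType.
Implicit Types U V W X : lmodType k.

Definition lin V W (f : V -> W) : Prop := linear f.

Lemma linI V W (f : V -> W) : lin f -> linear f. Proof. by []. Qed.
Lemma bilinI V W U (B : V -> W -> U) : (forall w, lin (fun v => B v w)) ->
  (forall v, lin (fun w => B v w)) -> bilin B.
Proof. by []. Qed.
Lemma lin0 V W (f : V -> W) : lin f -> f 0 = 0.
Proof. by move=> h; rewrite -[f]/(mklin h : V -> W) linear0. Qed.
Lemma linZ V W (f : V -> W) a x : lin f -> f (a *: x) = a *: f x.
Proof. by move=> h; rewrite -[f]/(mklin h : V -> W) linearZ. Qed.
Lemma lin_comp U V W (f : V -> W) (g : U -> V) :
  lin f -> lin g -> lin (fun x => f (g x)).
Proof. by move=> hf hg a x y; rewrite hg hf. Qed.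
Lemma lin_id V : lin (fun x : V => x).
Proof. by []. Qed.
Lemma lin_bil U V W X (B : V -> W -> X) (g : U -> V) w :
  bilin B -> lin g -> lin (fun x => B (g x) w).
Proof. by move=> hB hg a x y; rewrite hg hB.1. Qed.
Lemma lin_bir V W X (B : V -> W -> X) v : bilin B -> lin (B v).
Proof. by move=> hB a x y; rewrite hB.2. Qed.
Lemma lin_app U V W (F : U -> {linear V -> W}) w :
  lin F -> lin (fun x => F x w).
Proof. by move=> hF a x y; rewrite hF. Qed.
Lemma lin_tsum U V W X (B : U -> V -> W -> X) t :
  (forall a b, lin (fun x => B x a b)) -> lin (fun x => tsum (B x) t).
Proof.
move=> hB a x y; rewrite /tsum /tsumseq scaler_sumr -big_split.
by apply: eq_bigr => p _; apply: hB.
Qed.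
Lemma lin_tsumr V W X (B : V -> W -> X) : bilin B -> lin (tsum B).
Proof. exact: tsum_linear. Qed.
Lemma lin_fun V W (f : {linear V -> W}) : lin f.
Proof. by move=> a x y; rewrite linearP. Qed.
Lemma bilin_scale V : bilin (fun (a : k^o) (v : V) => a *: v).
Proof. by split=> [v|b] a x y; rewrite ?scalerDl ?scalerDr ?scalerA // mulrC. Qed.
Lemma lin_scalel U V (g : U -> k) (v : V) :
  @lin U k^o g -> lin (fun x => g x *: v).
Proof. by move=> hg a x y; rewrite hg scalerDl scalerA. Qed.
Lemma bilin_mul (A : algType k) : bilin (fun x y : A => x * y).
Proof. 
by split=> [v|b] a x y /=; rewrite ?mulrDl ?mulrDr -?scalerAr -?scalerAl.
Qed.

Lemma eq_tsum V W U (F G : V -> W -> U) t : (forall a b, F a b = G a b) ->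
  tsum F t = tsum G t.
Proof. by move=> e; apply: eq_bigr => p _; apply: e. Qed.
Lemma tsum_f V W U X (f : U -> X) (F : V -> W -> U) t : lin f ->
  f (tsum F t) = \sw_(a, b <- t) f (F a b).
Proof. by move=> h; rewrite -[f]/(mklin h : U -> X) linear_sum. Qed.
Lemma tsumZ V W U c (F : V -> W -> U) t : \sw_(a, b <- t) (c *: F a b) = c *: \sw_(a, b <- t) F a b.
Proof. by rewrite /tsum /tsumseq scaler_sumr. Qed.
Lemma tsum_tsum V W V' W' U (B : V' -> W' -> U) (F : V -> W -> tensor V' W') t :
  bilin B -> tsum B (tsum F t) = \sw_(a, b <- t) tsum B (F a b).
Proof. by move=> h; apply: tsum_f; apply: lin_tsumr. Qed.
Lemma linear_tsum V W U X (f : {linear U -> X}) (F : V -> W -> U) t :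
  f (tsum F t) = \sw_(a, b <- t) f (F a b).
Proof. exact/tsum_f/lin_fun. Qed.
Lemma exch_tsum V W (V' W' U : lmodType k) (F : V -> W -> V' -> W' -> U) s t :
  \sw_(a, b <- s) \sw_(c, d <- t) F a b c d =
  \sw_(c, d <- t) \sw_(a, b <- s) F a b c d.
Proof. exact: exchange_big. Qed.
Lemma tsum_lift V W U (f : tensor V W -> U) t : lin f ->
  f t = \sw_(a, b <- t) f (a ⊗ b).
Proof. by move=> h; rewrite -tsum_f // tsum_tens. Qed.
End LinTools.
Arguments tsum_f {k V W U X f F t}.

Ltac lin_atom := fail.
Ltac lin :=
  lazymatch goal with
  | |- bilin _ => first [lin_atom | exact: tens_bilin | exact: bilin_mul
        | exact: bilin_scale | apply: bilinI; move=> ?; lin_body]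
  | |- GRing.linear_for _ _ => apply: linI; lin_body
  | |- lin _ => lin_body
  end
with lin_body := cbv beta;
  match goal with
  | |- lin (fun x => x) => exact: lin_id
  | h : context [lin _] |- lin _ => solve [apply: h]
  | |- @lin ?k ?U ?W (fun x => tsum (fun a b => @?F x a b) ?t) =>
      apply: (@lin_tsum k U _ _ W F t); move=> ? ?; lin_body
  | |- @lin ?k ?U ?W (fun x => tsum ?B (@?g x)) =>
      apply: (@lin_comp k U _ W (tsum B) g); [apply: lin_tsumr; lin | lin_body]
  | |- @lin ?k ?U ?W (fun x => ?f x) => change (@lin k U W f);
      first [lin_atom | apply: lin_fun | apply: lin_bir; lin]
  | |- @lin ?k ?U ?W (fun x => GRing.Linear.sort (@?F x) ?w) =>
      apply: (@lin_app k U _ W F w); lin_body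
  | |- @lin ?k ?U ?W (fun x => GRing.scale (@?g x) ?w) =>
      apply: (@lin_scalel k U W g w); lin_body
  | |- @lin ?k ?U ?W (fun x => ?B (@?g x) ?w) =>
      apply: (@lin_bil k U _ _ W B g w); [lin | lin_body]
  | |- @lin ?k ?U ?W (fun x => ?f (@?g x)) =>
      apply: (@lin_comp k U _ W f g);
      [first [lin_atom | apply: lin_fun | apply: lin_bir; lin] | lin_body]
  | |- lin _ => first [lin_atom | apply: lin_fun | apply: lin_bir; lin | apply: lin_tsumr; lin]
  end.

#[export] Hint Extern 0 (lin _) => lin_body : core.
#[export] Hint Extern 0 (bilin _) => lin : core.

Record hopfAlgebra (k : fieldType) := HopfAlgebra {
  hopf_alg :> algType k;
  comul : {linear hopf_alg -> tensor hopf_alg hopf_alg};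
  counit : {lrmorphism hopf_alg -> k | *%R};
  antipode : {linear hopf_alg -> hopf_alg};
  antipodeV : hopf_alg -> hopf_alg;
  comulA : forall h, \sw_(a, b <- comul h) comul a ⊗ b =
     \sw_(a, b <- comul h) \sw_(c, d <- comul b) a ⊗ c ⊗ d;
  counitl : forall h, \sw_(a, b <- comul h) counit a *: b = h;
  counitr : forall h, \sw_(a, b <- comul h) counit b *: a = h;
  comul1 : comul 1 = 1 ⊗ 1;
  comulM : forall g h, comul (g * h) =
     \sw_(a, b <- comul g) \sw_(c, d <- comul h) (a * c) ⊗ (b * d);
  antipodel : forall h, \sw_(a, b <- comul h) antipode a * b = (counit h)%:A;
  antipoder : forall h, \sw_(a, b <- comul h) a * antipode b = (counit h)%:A;
  antipodeK : cancel antipode antipodeV;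
  antipodeVK : cancel antipodeV antipode
}.
Arguments comul {k h} : rename.
Arguments counit {k h} : rename.
Arguments antipode {k h} : rename.
Arguments antipodeV {k h} : rename.

Definition antipow (k : fieldType) (H : hopfAlgebra k) (n : int) : H -> H :=
  match n with
  | Posz m => iter m antipode
  | Negz m => iter m.+1 antipodeV
  end.
Notation "S^[ n ]" := (antipow n) (format "S^[ n ]").

Section HopfTheory.
Variables (k : fieldType) (H : hopfAlgebra k).
Implicit Types (g h x y : H) (U V W : lmodType k).

Lemma sw_assoc U (F : H -> H -> H -> U) h :
  (forall b c, lin (fun a => F a b c)) -> (forall a c, lin (fun b => F a b c)) ->
  (forall a b, lin (fun c => F a b c)) ->
  \sw_(a, b <- comul h) \sw_(c, d <- comul a) F c d b =
  \sw_(a, b <- comul h) \sw_(c, d <- comul b) F a c d.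
Proof.
move=> F1 F2 F3.
have b1 c : bilin (fun a b => F a b c) by split=> ?; [exact: F1|exact: F2].
have b2 : bilin (fun (t : tensor H H) d => \sw_(a, b <- t) F a b d).
  by split=> [?|?]; [exact: lin_tsumr|apply: lin_tsum => a b; exact: F3].
have /(congr1 (tsum (fun (t : tensor H H) d => \sw_(a, b <- t) F a b d))) := comulA h.
rewrite !(tsum_f (f := tsum (fun (t : tensor H H) d => _))); try exact: lin_tsumr.
under [in RHS]eq_tsum => a b. 
  rewrite !(tsum_f (f := tsum (fun (t : tensor H H) d => _))); last exact: lin_tsumr.
  under eq_tsum => c d do rewrite !tsumE //.
  over.
by under eq_tsum => a b do rewrite !tsumE //.
Qed.


Lemma counit_lin : @lin k H k^o counit.
Proof. by move=> a x y; rewrite linearP. Qed.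
Ltac lin_atom ::= first [exact: counit_lin].

Lemma sw_counitl U (f : H -> U) h : lin f -> \sw_(a, b <- comul h) (counit a *: f b) = f h.
Proof.
move=> hf; rewrite -{2}(counitl h) tsum_f //; apply: eq_tsum => a b.
by rewrite linZ.
Qed.
Lemma sw_counitr U (f : H -> U) h : lin f -> \sw_(a, b <- comul h) (counit b *: f a) = f h.
Proof.
move=> hf; rewrite -{2}(counitr h) tsum_f //; apply: eq_tsum => a b.
by rewrite linZ.
Qed.
Lemma sw_antipodel U (f : H -> U) h : lin f -> 
  \sw_(a, b <- comul h) f (antipode a * b) = counit h *: f 1.
Proof. by move=> hf; rewrite -tsum_f // antipodel linZ. Qed.
Lemma sw_antipoder U (f : H -> U) h : lin f ->
  \sw_(a, b <- comul h) f (a * antipode b) = counit h *: f 1.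
Proof. by move=> hf; rewrite -tsum_f // antipoder linZ. Qed.
Lemma sw_comulM U (F : H -> H -> U) g h : bilin F ->
  \sw_(a, b <- comul (g * h)) F a b =
  \sw_(a, b <- comul g) \sw_(c, d <- comul h) F (a * c) (b * d).
Proof.
move=> hF; rewrite comulM (tsum_f (f := tsum F)); last exact: lin_tsumr.
apply: eq_tsum => a b; rewrite (tsum_f (f := tsum F)); last exact: lin_tsumr.
by apply: eq_tsum => c d; rewrite tsumE.
Qed.

Lemma antipode1 : antipode 1 = 1 :> H.
Proof.
have := antipodel (1 : H); rewrite comul1 tsumE; last by lin.
by rewrite mulr1 => ->; rewrite rmorph1 scale1r.
Qed.

Lemma antipodeM g h : antipode (g * h) = antipode h * antipode g.
Proof.
pose E := \sw_(a, b <- comul g) \sw_(c, d <- comul b) 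
  \sw_(p, q <- comul h) \sw_(r, s <- comul q)
    antipode (a * p) * (c * r) * (antipode s * antipode d).
transitivity E.
- symmetry; rewrite /E.
  under eq_tsum => a b do under eq_tsum => c d do under eq_tsum => p q do
    under eq_tsum => r s do rewrite -mulrA -(mulrA c) (mulrA r).
  under eq_tsum => a b do under eq_tsum => c d do under eq_tsum => p q do
    rewrite (sw_antipoder (f := fun z => antipode (a * p) * (c * (z * antipode d)))) //.
  under eq_tsum => a b do under eq_tsum => c d do 
    rewrite (sw_counitr (f := fun p => antipode (a * p) * (c * (1 * antipode d)))) ?mul1r //.
  under eq_tsum => a b do rewrite (sw_antipoder (f := fun z => antipode (a * h) * z)) ?mulr1 //.
  by rewrite (sw_counitr (f := fun p => antipode (p * h))) //.
- rewrite /E.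
  rewrite -(sw_assoc (F := fun a c d => \sw_(p, q <- comul h) \sw_(r, s <- comul q)
    antipode (a * p) * (c * r) * (antipode s * antipode d))) //.
  under eq_tsum => a b do under eq_tsum => c d do
    rewrite -(sw_assoc (F := fun p r s => antipode (c * p) * (d * r) * (antipode s * antipode b))) //.
  under eq_tsum => a b.
    rewrite exch_tsum.
    under eq_tsum => p q do rewrite -(sw_comulM (F := fun u v => antipode u * v * (antipode q * antipode b))) //.
    under eq_tsum => p q do rewrite (sw_antipodel (f := fun u => u * (antipode q * antipode b))) // rmorphM mul1r -scalerA.
    rewrite tsumZ.
    rewrite (sw_counitl (f := fun q => antipode q * antipode b)) //.
    over.
  by rewrite (sw_counitl (f := fun b => antipode h * antipode b)).
Qed.

Lemma counit_antipode h : counit (antipode h) = counit h.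
Proof.
have := tsum_f (F := fun a b : H => antipode a * b) (t := comul h) counit_lin.
rewrite /= antipodel linearZ rmorph1 /= mulr1 => ->; symmetry.
under eq_tsum => a b do rewrite rmorphM mulrC -[_ * _]/(counit b *: (_ : k^o)).
by rewrite (sw_counitr (U := k^o) (f := fun a => counit (antipode a))).
Qed.

Definition tmul (s t : tensor H H) : tensor H H :=
  \sw_(a, b <- s) \sw_(c, d <- t) (a * c) ⊗ (b * d).

Lemma tmul_bilin : bilin tmul.
Proof. by rewrite /tmul; lin. Qed.

Lemma tmulE a b c d : tmul (a ⊗ b) (c ⊗ d) = (a * c) ⊗ (b * d).
Proof. by rewrite /tmul tsumE // tsumE. Qed.

Ltac lin_atom ::= first [exact: counit_lin | exact: tmul_bilin].

Lemma tmulA s t u : tmul s (tmul t u) = tmul (tmul s t) u.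
Proof.
rewrite (tsum_lift (f := fun s => tmul s _)) // (tsum_lift (f := fun s => tmul (tmul s _) _)) //.
apply: eq_tsum => a b.
rewrite (tsum_lift (f := fun t => tmul _ (tmul t _))) // (tsum_lift (f := fun t => tmul (tmul _ t) _)) //.
apply: eq_tsum => c d.
rewrite (tsum_lift (f := fun u => tmul _ (tmul _ u))) // (tsum_lift (f := fun u => tmul _ u)) //.
by apply: eq_tsum => e f; rewrite !tmulE !mulrA.
Qed.

Lemma tmul1t t : tmul (1 ⊗ 1) t = t.
Proof.
rewrite -{2}(tsum_tens t) (tsum_lift (f := tmul _)) //.
by apply: eq_tsum => c d; rewrite tmulE !mul1r.
Qed.
Lemma tmult1 t : tmul t (1 ⊗ 1) = t.
Proof.
rewrite -{2}(tsum_tens t) (tsum_lift (f := fun t => tmul t _)) //.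
by apply: eq_tsum => c d; rewrite tmulE !mulr1.
Qed.

Lemma comulM_tmul g h : comul (g * h) = tmul (comul g) (comul h).
Proof. exact: comulM. Qed.

Lemma sw_antipode_mid h : 
  \sw_(a, b <- comul h) tmul (comul a) (\sw_(c, d <- comul b) antipode d ⊗ antipode c) = counit h *: (1 ⊗ 1).
Proof.
under eq_tsum => a b.
  rewrite -{1}(tsum_tens (comul a)) (tsum_f (f := fun t => tmul t _)) //.
  under eq_tsum => x y.
    rewrite (tsum_f (f := tmul _)) //.
    under eq_tsum => c d do rewrite tmulE.
    over.
  over.
rewrite (sw_assoc (F := fun x y b => \sw_(c, d <- comul b) (x * antipode d) ⊗ (y * antipode c))) //.
under eq_tsum => a b.
  rewrite -(sw_assoc (F := fun y c d => (a * antipode d) ⊗ (y * antipode c))) //.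
  under eq_tsum => c d do rewrite (sw_antipoder (f := fun z => (a * antipode d) ⊗ z)) //.
  rewrite (sw_counitl (f := fun d => (a * antipode d) ⊗ 1)) //.
  over.
by rewrite (sw_antipoder (f := fun z => z ⊗ 1)).
Qed.

Lemma comul_antipode h :
  comul (antipode h) = \sw_(a, b <- comul h) antipode b ⊗ antipode a.
Proof.
pose E := \sw_(a, b <- comul h) \sw_(c, d <- comul b)
  tmul (comul (antipode a)) (tmul (comul c) (\sw_(p, q <- comul d) antipode q ⊗ antipode p)).
transitivity E.
- rewrite /E; symmetry.
  under eq_tsum => a b do rewrite -(tsum_f (f := tmul _) (F := fun c d : H => tmul (comul c) (\sw_(p, q <- comul d) antipode q ⊗ antipode p))) // sw_antipode_mid linZ // tmult1.
  by rewrite (sw_counitr (f := fun a => comul (antipode a))).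
- rewrite /E.
  rewrite -(sw_assoc (F := fun a c d => tmul (comul (antipode a)) (tmul (comul c) (\sw_(p, q <- comul d) antipode q ⊗ antipode p)))) //.
  under eq_tsum => a b.
    under eq_tsum => c d do rewrite tmulA -comulM_tmul.
    rewrite (sw_antipodel (f := fun z => tmul (comul z) _)) // comul1 tmul1t.
    over.
  by rewrite (sw_counitl (f := fun b => \sw_(p, q <- comul b) antipode q ⊗ antipode p)).
Qed.

Lemma antipow_add m n h : S^[m + n] h = S^[m] (S^[n] h).
Proof.
have succ (p : int) x : S^[p + 1] x = antipode (S^[p] x).
  case: p => [p|[|p]]; first by rewrite -PoszD addn1.
  - by rewrite NegzE addNr /= antipodeVK.
  - have -> : Negz p.+1 + 1 = Negz p by rewrite !NegzE -addn1 PoszD opprD addrNK.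
    by rewrite /= antipodeVK.
have pred (p : int) x : S^[p - 1] x = antipodeV (S^[p] x).
  by rewrite -{2}[p](subrK 1) succ antipodeK.
elim: m h => [|m IH|m IH] h; first by rewrite add0r.
- by rewrite -addn1 PoszD -addrA [1 + _]addrC addrA succ IH succ.
- by rewrite -addn1 PoszD opprD -addrA [-1 + _]addrC addrA pred IH pred.
Qed.

Lemma antipow1 h : S^[1] h = antipode h. Proof. by []. Qed.
Lemma antipow0 h : S^[0] h = h. Proof. by []. Qed.
Lemma antipow_lin n : lin (@antipow k H n).
Proof.
have l : lin (@antipodeV k H).
  by move=> a x y; apply: (can_inj (@antipodeK k H)); rewrite linearP !antipodeVK.
have iterl (f : H -> H) m : lin f -> lin (iter m f).
  by move=> hf; elim: m => [|m IH]; [exact: lin_id|exact: lin_comp hf IH].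
by case: n => n; apply: iterl => //; apply: lin_fun.
Qed.
Ltac lin_atom ::= first [exact: counit_lin | exact: tmul_bilin | exact: antipow_lin].

Definition hopf_end (f : H -> H) :=
  [/\ lin f, f 1 = 1, {morph f : x y / x * y}, forall h, counit (f h) = counit h &
   forall h, comul (f h) = \sw_(a, b <- comul h) f a ⊗ f b].


Lemma sw_hopf_end U (f : H -> H) (F : H -> H -> U) h : hopf_end f -> bilin F ->
  \sw_(a, b <- comul (f h)) F a b = \sw_(a, b <- comul h) F (f a) (f b).
Proof. by move=> [_ _ _ _ ->] hF; rewrite tsum_tsum //; apply: eq_tsum => a b; rewrite tsumE. Qed.

Lemma sw_comul_antipode U (F : H -> H -> U) h : bilin F ->
  \sw_(a, b <- comul (antipode h)) F a b = \sw_(a, b <- comul h) F (antipode b) (antipode a).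
Proof. by move=> hF; rewrite comul_antipode tsum_tsum //; apply: eq_tsum => a b; rewrite tsumE. Qed.

Lemma sw_split5 U (K : H -> H -> H -> H -> H -> U) h :
  (forall b c d e, lin (fun a => K a b c d e)) ->
  (forall a c d e, lin (fun b => K a b c d e)) ->
  (forall a b d e, lin (fun c => K a b c d e)) ->
  (forall a b c e, lin (fun d => K a b c d e)) ->
  (forall a b c d, lin (fun e => K a b c d e)) ->
  \sw_(h1, h' <- comul h) \sw_(h2, h3 <- comul h')
    \sw_(c, d <- comul h1) \sw_(a, b <- comul h3) K c d h2 a b =
  \sw_(h1, h' <- comul h) \sw_(h2, h3 <- comul h')
    \sw_(p, q <- comul h2) \sw_(r, s <- comul q) K h1 p r s h3.
Proof.
move=> K1 K2 K3 K4 K5.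
under eq_tsum => h1 h' do rewrite exch_tsum.
rewrite (sw_assoc (F := fun c d h' => \sw_(h2, h3 <- comul h') \sw_(a, b <- comul h3) K c d h2 a b)) //.
apply: eq_tsum => c h''.
rewrite (sw_assoc (F := fun p q h3 => \sw_(r, s <- comul q) K c p r s h3)) //.
apply: eq_tsum => p q.
by rewrite (sw_assoc (F := fun r s h3 => K c p r s h3)).
Qed.

Lemma hopf_end_comp (f g : H -> H) : hopf_end f -> hopf_end g -> hopf_end (fun x => f (g x)).
Proof.
move=> [f1 f2 f3 f4 f5] [g1 g2 g3 g4 g5]; split; first exact: lin_comp.
- by rewrite g2.
- by move=> x y; rewrite g3 f3.
- by move=> x; rewrite f4 g4.
move=> h; rewrite f5 g5.
have hb : bilin (fun a b => f a ⊗ f b) by apply: bilinI => w; 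
 [apply: (lin_comp (f := fun z => z ⊗ f w))|apply: lin_comp].
rewrite (tsum_f (f := tsum (fun a b => f a ⊗ f b))); last exact: lin_tsumr.
by apply: eq_tsum => a b; rewrite tsumE.
Qed.

Lemma hopf_end_inv (f g : H -> H) : cancel f g -> cancel g f -> hopf_end f -> hopf_end g.
Proof.
move=> fK gK [f1 f2 f3 f4 f5].
have gl : lin g by move=> a x y; apply: (can_inj fK); rewrite f1 !gK.
split=> //.
- by rewrite -[in LHS]f2 fK.
- by move=> x y; apply: (can_inj fK); rewrite f3 !gK.
- by move=> x; rewrite -f4 gK.
move=> h; rewrite -{2}[h]gK f5.
have hb : bilin (fun a b => g a ⊗ g b) by apply: bilinI => w; 
 [apply: (lin_comp (f := fun z => z ⊗ g w))|apply: lin_comp].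
rewrite (tsum_f (f := tsum (fun a b => g a ⊗ g b))); last exact: lin_tsumr.
rewrite -[LHS]tsum_tens.
by apply: eq_tsum => a b; rewrite tsumE ?fK.
Qed.

Lemma hopf_end_ext (f g : H -> H) : f =1 g -> hopf_end f -> hopf_end g.
Proof. by move=> /funext ->. Qed.

Lemma antipowK n : cancel (@antipow k H n) (S^[- n]).
Proof. by move=> x; rewrite -antipow_add addNr. Qed.
Lemma antipowNK n : cancel (@antipow k H (- n)) (S^[n]).
Proof. by move=> x; rewrite -antipow_add addrN. Qed.

Lemma hopf_end_antipow (i : int) : hopf_end S^[2 * i].
Proof.
have h2 : hopf_end S^[2].
  split=> //; first by rewrite /= !antipode1.
  - by move=> x y; rewrite /= !antipodeM.
  - by move=> x; rewrite /= !counit_antipode.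
  move=> x; rewrite [S^[2] x]/= comul_antipode.
  have hb : bilin (fun a b : H => antipode b ⊗ antipode a) by [].
  rewrite comul_antipode (tsum_f (f := tsum (fun a b : H => antipode b ⊗ antipode a))) //.
  by apply: eq_tsum => a b; rewrite tsumE.
have h2' : hopf_end S^[-2] := hopf_end_inv (antipowK 2) (antipowNK 2) h2.
elim: i => [|i IH|i IH]; first split=> //.
- by move=> h; rewrite -[LHS]tsum_tens.
- apply: hopf_end_ext (hopf_end_comp h2 IH) => x.
  by rewrite -antipow_add (intS i) mulrDr mulr1.
- apply: hopf_end_ext (hopf_end_comp h2' IH) => x.
  by rewrite -antipow_add (intS i) (opprD 1 (Posz i)) mulrDr mulrN1.
Qed.
End HopfTheory.



HB.instance Definition _ (k : fieldType) (V W : lmodType k) (v : V) :=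
  GRing.isLinear.Build k W (tensor V W) *:%R (tens v) ((tens_bilin V W).2 v).
HB.instance Definition _ (k : fieldType) (H : hopfAlgebra k) (n : int) :=
  GRing.isLinear.Build k H H *:%R (@antipow k H n) (@antipow_lin k H n).

Section Modules.
Variables (k : fieldType) (H : hopfAlgebra k).
Implicit Types (i j n : int) (h x : H) (U : lmodType k).

Definition comodule_map (V W : lmodType k) (rV : V -> tensor V H)
    (rW : W -> tensor W H) (f : V -> W) : Prop :=
  forall v, rW (f v) = \sw_(v0, v1 <- rV v) f v0 ⊗ v1.

Record hmodule := HModule {
  hmodule_sort :> lmodType k;
  hact : H -> hmodule_sort -> hmodule_sort;
  hact_bilin : bilin hact;
  hact1 : forall m, hact 1 m = m;
  hactM : forall g h m, hact (g * h) m = hact g (hact h m)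
}.

Record YDmod (j : int) := YDMod {
  ydmod_hmodule :> hmodule;
  coact : {linear ydmod_hmodule -> tensor ydmod_hmodule H};
  coactA : forall m, \sw_(m0, m1 <- coact m) coact m0 ⊗ m1 =
    \sw_(m0, m1 <- coact m) \sw_(a, b <- comul m1) m0 ⊗ a ⊗ b;
  coact_counit : forall m, \sw_(m0, m1 <- coact m) counit m1 *: m0 = m;
  coact_act : forall h m, coact (hact h m) =
    \sw_(h1, h' <- comul h) \sw_(h2, h3 <- comul h') \sw_(m0, m1 <- coact m)
      hact h2 m0 ⊗ (h3 * m1 * S^[-1 - 2 * j] h1)
}.

Arguments coact {j y} : rename.

Record YDmod_hom j (M N : YDmod j) := YDModHom {
  ydmod_hom_fun :> {linear M -> N};
  ydmod_hom_act : forall h m, ydmod_hom_fun (hact h m) = hact h (ydmod_hom_fun m);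
  ydmod_hom_coact : comodule_map (@coact j M) (@coact j N) ydmod_hom_fun
}.

Ltac lin_atom ::= first [exact: counit_lin | exact: tmul_bilin | exact: hact_bilin].

Lemma yd_conj_subproof n (N : hmodule) (h : H) (f : {linear H -> N}) :
  linear (fun x => \sw_(h1, h' <- comul h) \sw_(h2, h3 <- comul h')
      hact h2 (f (antipode h3 * x * S^[n] h1))).
Proof. by lin. Qed.

Definition yd_conj n (N : hmodule) (h : H) (f : {linear H -> N}) : {linear H -> N} :=
  mklin (yd_conj_subproof n h f).

Lemma tcurry_subproof (V W U : lmodType k) (f : {linear tensor V W -> U}) :
  linear (fun v : V => (f \o tens v : {linear W -> U})).
Proof. by move=> a x y; apply: linP => w /=; rewrite (tens_bilin V W).1 linearP. Qed.

Definition tcurry (V W U : lmodType k) (f : {linear tensor V W -> U}) :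
  {linear V -> {linear W -> U}} := mklin (tcurry_subproof f).

Lemma counit_scale_subproof (N : lmodType k) (n : N) : linear (fun h : H => counit h *: n).
Proof. by move=> a x y; rewrite linearP scalerDl scalerA. Qed.

Definition counit_scale (N : lmodType k) (n : N) : {linear H -> N} := mklin (counit_scale_subproof n).

Record YDctr (j : int) := YDCtr {
  ydctr_hmodule :> hmodule;
  contra : {linear {linear H -> ydctr_hmodule} -> ydctr_hmodule};
  contraA : forall f : {linear tensor H H -> ydctr_hmodule},
    contra (contra \o tcurry f) = contra (f \o comul);
  contra_counit : forall y : ydctr_hmodule, contra (counit_scale y) = y;
  contra_act : forall h f, hact h (contra f) = contra (yd_conj (2 - 2 * j) h f)
}.

Record YDctr_hom j (M N : YDctr j) := YDCtrHom {
  ydctr_hom_fun :> {linear M -> N};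
  ydctr_hom_act : forall h m, ydctr_hom_fun (hact h m) = hact h (ydctr_hom_fun m);
  ydctr_hom_contra : forall f : {linear H -> M},
    ydctr_hom_fun (contra M f) = contra N (ydctr_hom_fun \o f)
}.

Lemma ydctr_hom_ext j (M N : YDctr j) (f g : YDctr_hom M N) : f =1 g -> f = g.
Proof.
case: f g => [f fa fc] [g ga gc] /= /linP e; case: _ / e in ga gc *.
by rewrite (Prop_irrelevance fa ga) (Prop_irrelevance fc gc).
Qed.

Section Comp.
Variables (j : int) (M N P : YDctr j) (g : YDctr_hom N P) (f : YDctr_hom M N).
Lemma ydctr_comp_act h m : (g \o f) (hact h m) = hact h ((g \o f) m).
Proof. by rewrite /= !ydctr_hom_act. Qed.
Lemma ydctr_comp_contra (u : {linear H -> M}) :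
  (g \o f) (contra M u) = contra P ((g \o f) \o u).
Proof. by rewrite /= !ydctr_hom_contra; congr (contra P _); apply: linP. Qed.
Definition ydctr_comp : YDctr_hom M P := YDCtrHom ydctr_comp_act ydctr_comp_contra.
End Comp.


Definition ydctr_iso j (M N : YDctr j) (f : YDctr_hom M N) : Prop :=
  exists g : YDctr_hom N M, cancel f g /\ cancel g f.

Section Tools.
Variables (j : int) (M : YDmod j).
Let aM := hact_bilin M.

Lemma sw_coactA U (F : M -> H -> H -> U) m :
  (forall b c, lin (fun a => F a b c)) -> (forall a c, lin (fun b => F a b c)) ->
  (forall a b, lin (fun c => F a b c)) ->
  \sw_(m0, m1 <- coact m) \sw_(a, b <- coact m0) F a b m1 =
  \sw_(m0, m1 <- coact m) \sw_(a, b <- comul m1) F m0 a b :> U.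
Proof.
move=> F1 F2 F3.
have b1 c : bilin (fun a b => F a b c) by split=> ?; [exact: F1|exact: F2].
have b2 : bilin (fun (t : tensor M H) d => \sw_(a, b <- t) F a b d).
  by split=> [?|?]; [exact: lin_tsumr|apply: lin_tsum => a b; exact: F3].
have /(congr1 (tsum (fun (t : tensor M H) d => \sw_(a, b <- t) F a b d))) := coactA m.
rewrite !(tsum_f (f := tsum (fun (t : tensor M H) d => _))); try exact: lin_tsumr.
under [in RHS]eq_tsum => a b.
  rewrite !(tsum_f (f := tsum (fun (t : tensor M H) d => _))); last exact: lin_tsumr.
  under eq_tsum => c d do rewrite !tsumE //.
  over.
by under eq_tsum => a b do rewrite !tsumE //.
Qed.

Lemma sw_coact_counit U (f : M -> U) m : lin f ->
  \sw_(m0, m1 <- coact m) (counit m1 *: f m0) = f m.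
Proof.
move=> hf; rewrite -{2}(coact_counit m) tsum_f //; apply: eq_tsum => a b.
by rewrite linZ.
Qed.
End Tools.

Section TwistMod.
Variables (i : int).

Section TwistHmodule.
Variable M : hmodule.
Definition twist_act (h : H) (m : M) : M := hact (S^[2 * i] h) m.
Lemma twist_act_bilin : bilin twist_act. Proof. by rewrite /twist_act. Qed.
Lemma twist_act1 m : twist_act 1 m = m.
Proof. by rewrite /twist_act; have [_ -> _ _ _] := hopf_end_antipow H i; rewrite hact1. Qed.
Lemma twist_actM g h m : twist_act (g * h) m = twist_act g (twist_act h m).
Proof. by rewrite /twist_act; have [_ _ -> _ _] := hopf_end_antipow H i; rewrite hactM. Qed.
Definition twist_hmodule : hmodule := HModule twist_act_bilin twist_act1 twist_actM.
End TwistHmodule.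

Section TwistYDmod.
Variables (j : int) (M : YDmod j).
Let T := @antipow k H (- (2 * i)).
Let hT : hopf_end T. Proof. by rewrite /T -mulrN; apply: hopf_end_antipow. Qed.

Lemma twist_coact_subproof :
  linear (fun m : M => \sw_(m0, m1 <- coact m) (m0 ⊗ S^[- (2 * i)] m1)).
Proof. lin. Qed.
Definition twist_coact : {linear twist_hmodule M -> tensor (twist_hmodule M) H} :=
  mklin twist_coact_subproof.

Lemma sw_twist_coact U (B : M -> H -> U) (m : M) : bilin B ->
  \sw_(a, b <- twist_coact m) B a b = \sw_(a, b <- coact m) B a (T b).
Proof. by move=> hB; rewrite tsum_tsum //; apply: eq_tsum => a b; rewrite tsumE. Qed.

Lemma twist_coactA m : \sw_(m0, m1 <- twist_coact m) twist_coact m0 ⊗ m1 =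
    \sw_(m0, m1 <- twist_coact m) \sw_(a, b <- comul m1) m0 ⊗ a ⊗ b.
Proof.
rewrite !sw_twist_coact //.
under eq_tsum => a b do rewrite /= (tsum_f (f := fun z => z ⊗ T b)) //.
rewrite (sw_coactA (F := fun a b c => (a ⊗ T b) ⊗ T c)) //.
by apply: eq_tsum => a b; rewrite (sw_hopf_end b hT).
Qed.

Lemma twist_coact_counit m : \sw_(m0, m1 <- twist_coact m) counit m1 *: m0 = m.
Proof.
rewrite sw_twist_coact // -[RHS](coact_counit (m : M)).
by apply: eq_tsum => a b; have [_ _ _ -> _] := hT.
Qed.

Lemma twist_coact_act h (m : twist_hmodule M) : twist_coact (hact h m) =
    \sw_(h1, h' <- comul h) \sw_(h2, h3 <- comul h') \sw_(m0, m1 <- twist_coact m)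
      hact h2 m0 ⊗ (h3 * m1 * S^[-1 - 2 * j] h1).
Proof.
have h2i := hopf_end_antipow H i.
rewrite /= /twist_act coact_act tsum_tsum //.
rewrite (sw_hopf_end h h2i) //; apply: eq_tsum => h1 h'.
rewrite (sw_hopf_end h' h2i) // tsum_tsum //; apply: eq_tsum => h2 h3.
rewrite tsum_tsum // [RHS]sw_twist_coact //.
apply: eq_tsum => m0 m1; rewrite tsumE //.
have [_ _ TM _ _] := hT.
rewrite -/T !TM /T -!antipow_add addNr antipow0.
by rewrite [X in S^[X] h1]addrAC addNr add0r.
Qed.

Definition twist_mod : YDmod j :=
  YDMod twist_coactA twist_coact_counit twist_coact_act.
End TwistYDmod.

Section TwistYDctr.
Variables (j : int) (N : YDctr j).
Let T := @antipow k H (- (2 * i)).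
Let hT : hopf_end T. Proof. by rewrite /T -mulrN; apply: hopf_end_antipow. Qed.

Lemma twist_contra_subproof :
  linear (fun f : {linear H -> twist_hmodule N} =>
    contra N (f \o S^[- (2 * i)]) : twist_hmodule N).
Proof.
move=> a f g; rewrite -[RHS](linearP (contra N)).
by congr (contra N _); apply: linP.
Qed.
Definition twist_contra :
  {linear {linear H -> twist_hmodule N} -> twist_hmodule N} := mklin twist_contra_subproof.

Lemma twist_contraA (f : {linear tensor H H -> twist_hmodule N}) :
    twist_contra (twist_contra \o tcurry f) = twist_contra (f \o comul).
Proof.
have l : linear (fun t : tensor H H => \sw_(a, b <- t) (f (T a ⊗ T b) : N)).
  by rewrite /T; lin.
have := contraA (mklin l : {linear tensor H H -> N}).
congr (_ = _); rewrite /=; congr (contra N _); apply: linP => x /=.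
  congr (contra N _); apply: linP => y /=.
  by rewrite tsumE // /T.
by have [_ _ _ _ ->] := hT; rewrite linear_tsum.
Qed.

Lemma twist_contra_counit (y : twist_hmodule N) : twist_contra (counit_scale y) = y.
Proof.
rewrite -[RHS](contra_counit (y : N)) /=; congr (contra N _); apply: linP => x /=.
by have [_ _ _ -> _] := hT.
Qed.

Lemma twist_contra_act h (f : {linear H -> twist_hmodule N}) :
  hact h (twist_contra f) = twist_contra (yd_conj (2 - 2 * j) h f).
Proof.
have h2i := hopf_end_antipow H i.
rewrite /= /twist_act contra_act; congr (contra N _); apply: linP => x /=.
rewrite (sw_hopf_end h h2i) //; apply: eq_tsum => h1 h'.
rewrite (sw_hopf_end h' h2i) //; apply: eq_tsum => h2 h3.
rewrite /twist_act; congr (hact _ (f _)).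
have [_ _ TM _ _] := hT.
rewrite -/T !TM /T -[antipode _]/(S^[1] _) -!antipow_add.
by rewrite [X in S^[X] h1]addrAC [X in S^[X] h3]addrAC addNr !add0r antipow1.
Qed.

Definition twist_ctr : YDctr j :=
  YDCtr twist_contraA twist_contra_counit twist_contra_act.
End TwistYDctr.
End TwistMod.

End Modules.
Arguments coact {k H j y} : rename.
Arguments hact {k H h} : rename.
Arguments contra {k H j} y : rename.


Ltac lin_atom ::= first [exact: counit_lin | exact: tmul_bilin | exact: hact_bilin].

Section Diagram.
Variables (k : fieldType) (H : hopfAlgebra k).
Implicit Types (i j n : int) (h x : H) (U : lmodType k).

Lemma antipow_antipode n x : antipode (S^[n] x) = S^[n] (antipode x).
Proof. by rewrite -[LHS]/(S^[1] _) -[antipode x]/(S^[1] x) -!antipow_add addrC. Qed.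


Lemma sw_conj7 U (Q : H -> H -> H -> H -> H -> U) h :
  (forall b c d e, lin (fun a => Q a b c d e)) ->
  (forall a c d e, lin (fun b => Q a b c d e)) ->
  (forall a b d e, lin (fun c => Q a b c d e)) ->
  (forall a b c e, lin (fun d => Q a b c d e)) ->
  (forall a b c d, lin (fun e => Q a b c d e)) ->
  \sw_(h1, h' <- comul h) \sw_(c, d <- comul h1) \sw_(h2, h3 <- comul h')
    \sw_(p, q <- comul h2) \sw_(r, s <- comul q) \sw_(a, b <- comul h3)
      Q c r b (s * antipode a) (d * antipode p) =
  \sw_(h1, h' <- comul h) \sw_(h2, h3 <- comul h') Q h1 h2 h3 1 1.
Proof.
move=> Q1 Q2 Q3 Q4 Q5.
rewrite (sw_assoc (F := fun c d h' => \sw_(h2, h3 <- comul h')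
    \sw_(p, q <- comul h2) \sw_(r, s <- comul q) \sw_(a, b <- comul h3)
      Q c r b (s * antipode a) (d * antipode p))) //.
apply: eq_tsum => c t.
under eq_tsum => d h' do rewrite (sw_assoc (F := fun p q h3 => \sw_(r, s <- comul q)
  \sw_(a, b <- comul h3) Q c r b (s * antipode a) (d * antipode p))) //.
rewrite -(sw_assoc (F := fun d p q' => \sw_(q, h3 <- comul q') \sw_(r, s <- comul q)
  \sw_(a, b <- comul h3) Q c r b (s * antipode a) (d * antipode p))) //.
under eq_tsum => e q' do rewrite (sw_antipoder (f := fun z => \sw_(q, h3 <- comul q')
  \sw_(r, s <- comul q) \sw_(a, b <- comul h3) Q c r b (s * antipode a) z)) //.
rewrite (sw_counitl (f := fun q' => \sw_(q, h3 <- comul q')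
  \sw_(r, s <- comul q) \sw_(a, b <- comul h3) Q c r b (s * antipode a) 1)) //.
rewrite (sw_assoc (F := fun r s h3 => \sw_(a, b <- comul h3) Q c r b (s * antipode a) 1)) //.
apply: eq_tsum => r u.
rewrite -(sw_assoc (F := fun s a b => Q c r b (s * antipode a) 1)) //.
under eq_tsum => e b do rewrite (sw_antipoder (f := fun z => Q c r b z 1)) //.
by rewrite (sw_counitl (f := fun b => Q c r b 1 1)).
Qed.

Section SigmaMod.
Variables (i : int) (M : YDmod H (i - 1)).

Lemma sigma_mod_subproof :
  linear (fun m : M => (\sw_(m0, m1 <- coact m) hact (S^[2 * i] m1) m0 : twist_mod i M)).
Proof. lin. Qed.

Definition sigma_mod_fun : {linear M -> twist_mod i M} := mklin sigma_mod_subproof.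

Lemma exp_mod : -1 - 2 * (i - 1) = - (2 * i) + 1.
Proof. by rewrite mulrBr mulr1 opprB addrA addrC; congr (_ + _). Qed.

Lemma antipow_exp_mod x : S^[-1 - 2 * (i - 1)] x = S^[- (2 * i)] (antipode x).
Proof. by rewrite exp_mod antipow_add. Qed.

Lemma sigma_mod_act h m : sigma_mod_fun (hact h m) = hact h (sigma_mod_fun m).
Proof.
have [_ _ TM _ _] := hopf_end_antipow H i.
rewrite /= coact_act tsum_tsum // /twist_act (tsum_f (f := hact _)) //.
under eq_tsum => h1 h'.
  rewrite tsum_tsum //.
  under eq_tsum => h2 h3.
    rewrite tsum_tsum //.
    under eq_tsum => m0 m1 do
      rewrite tsumE // antipow_exp_mod !TM antipowNK -hactM -mulrA.
    over.
  rewrite exch_tsum.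
  over.
rewrite exch_tsum; apply: eq_tsum => m0 m1.
rewrite -(sw_assoc (F := fun h1 h2 h3 =>
  hact (S^[2 * i] h3 * S^[2 * i] m1 * (antipode h1 * h2)) m0)) //.
under eq_tsum => a b do rewrite (sw_antipodel (f := fun z => hact (S^[2 * i] b * S^[2 * i] m1 * z) m0)) //.
by rewrite (sw_counitl (f := fun b => hact (S^[2 * i] b * S^[2 * i] m1 * 1) m0)) // mulr1 hactM.
Qed.

Lemma sigma_mod_coact :
  comodule_map (@coact _ _ _ M) (@coact _ _ _ (twist_mod i M)) sigma_mod_fun.
Proof.
move=> m; rewrite /= (tsum_f (f := coact)) // tsum_tsum //.
have h2i := hopf_end_antipow H i.
under eq_tsum => m0 m1.
  rewrite coact_act tsum_tsum // (sw_hopf_end m1 h2i) //.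
  under eq_tsum => h1 h'.
    rewrite (sw_hopf_end h' h2i) // tsum_tsum //.
    under eq_tsum => h2 h3.
      rewrite tsum_tsum //.
      under eq_tsum => a b do rewrite tsumE // antipow_exp_mod antipow_antipode antipowK -mulrA.
      over.
    rewrite exch_tsum.
    over.
  rewrite exch_tsum.
  over.
rewrite (sw_coactA (F := fun a b t => \sw_(h1, h' <- comul t) \sw_(h2, h3 <- comul h')
  hact (S^[2 * i] h2) a ⊗ S^[- (2 * i)] (S^[2 * i] h3 * (b * antipode h1)))) //.
under eq_tsum => m0 m1.
  rewrite -(sw_assoc (F := fun b h1 h' => \sw_(h2, h3 <- comul h')
  hact (S^[2 * i] h2) m0 ⊗ S^[- (2 * i)] (S^[2 * i] h3 * (b * antipode h1)))) //.
  under eq_tsum => e h' do rewrite (sw_antipoder (f := fun z => \sw_(h2, h3 <- comul h')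
    hact (S^[2 * i] h2) m0 ⊗ S^[- (2 * i)] (S^[2 * i] h3 * z))) //.
  rewrite (sw_counitl (f := fun h' => \sw_(h2, h3 <- comul h')
    hact (S^[2 * i] h2) m0 ⊗ S^[- (2 * i)] (S^[2 * i] h3 * 1))) //.
  under eq_tsum => h2 h3 do rewrite mulr1 antipowK.
  over.
under [in RHS]eq_tsum => v0 v1 do rewrite (tsum_f (f := fun z => z ⊗ v1)) //.
by rewrite [RHS](sw_coactA (F := fun a b c => hact (S^[2 * i] b) a ⊗ c)).
Qed.

Definition sigma_mod : YDmod_hom M (twist_mod i M) :=
  YDModHom sigma_mod_act sigma_mod_coact.

End SigmaMod.

Section SigmaCtr.
Variables (i : int) (N : YDctr H (i + 1)).

Lemma act_hom_subproof (M : hmodule H) (m : M) : linear (fun h => hact h m).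
Proof. by lin. Qed.
Definition act_hom (M : hmodule H) (m : M) : {linear H -> M} := mklin (act_hom_subproof m).

Lemma sigma_ctr_subproof : linear (fun y : N => (contra N (act_hom y) : twist_ctr i N)).
Proof.
move=> a x y; rewrite -[RHS](linearP (contra N)); congr (contra N _).
by apply: linP => h /=; rewrite (hact_bilin N).2.
Qed.
Definition sigma_ctr_fun : {linear N -> twist_ctr i N} := mklin sigma_ctr_subproof.

Lemma exp_ctr : 2 - 2 * (i + 1) = - (2 * i).
Proof. by rewrite mulrDr mulr1 opprD addrCA addrN addr0. Qed.

Lemma sigma_ctr_act h y : sigma_ctr_fun (hact h y) = hact h (sigma_ctr_fun y).
Proof.
rewrite /= /twist_act contra_act; congr (contra N _); apply: linP => x /=.
rewrite exp_ctr (sw_hopf_end h (hopf_end_antipow H i)) //.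
under eq_tsum => h1 h'.
  under eq_tsum => h2 h3 do rewrite antipowK -hactM -mulrA mulrA.
  rewrite (sw_antipoder (f := fun z => hact (z * (x * h1)) y)) // mul1r.
  have [_ _ _ -> _] := hopf_end_antipow H i.
  over.
by rewrite (sw_counitr (f := fun h1 => hact (x * h1) y)) // hactM.
Qed.

Lemma sigma_ctr_contra (f : {linear H -> N}) :
  sigma_ctr_fun (contra N f) = contra (twist_ctr i N) (sigma_ctr_fun \o f).
Proof.
rewrite /=.
have [_ _ TM _ _] := hopf_end_antipow H (- i).
have hT := hopf_end_antipow H (- i); rewrite mulrN in hT.
have lL : linear (fun t : tensor H H => \sw_(x, h <- t) \sw_(x1, x' <- comul x)
   \sw_(x2, x3 <- comul x') hact x2 (f (antipode x3 * h * S^[- (2 * i)] x1))).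
  by lin.
have lR : linear (fun t : tensor H H => \sw_(x, h <- t) hact h (f (S^[- (2 * i)] x))).
  by lin.
transitivity (contra N (contra N \o tcurry (mklin lL))).
  congr (contra N _); apply: linP => x /=; rewrite contra_act; congr (contra N _).
  by apply: linP => h /=; rewrite tsumE // exp_ctr.
transitivity (contra N (contra N \o tcurry (mklin lR))); last first.
  congr (contra N _); apply: linP => x /=; congr (contra N _).
  by apply: linP => h /=; rewrite tsumE.
rewrite !contraA; congr (contra N _); apply: linP => x /=.
rewrite (sw_assoc (F := fun x1 x' h => 
   \sw_(x2, x3 <- comul x') hact x2 (f (antipode x3 * h * S^[- (2 * i)] x1)))) //.
apply: eq_tsum => x1 x'.
rewrite (sw_assoc (F := fun x2 x3 h => hact x2 (f (antipode x3 * h * S^[- (2 * i)] x1)))) //.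
under eq_tsum => x2 y do rewrite (sw_antipodel (f := fun z => hact x2 (f (z * S^[- (2 * i)] x1)))) //.
by rewrite (sw_counitr (f := fun x2 => hact x2 (f (1 * S^[- (2 * i)] x1)))) // mul1r.
Qed.

Definition sigma_ctr : YDctr_hom N (twist_ctr i N) :=
  YDCtrHom sigma_ctr_act sigma_ctr_contra.
End SigmaCtr.


Section Hat.
Variables (i : int) (M : YDmod H (i - 1)).

Definition colinear : {pred {linear H -> M}} :=
  fun f => `[< comodule_map comul (@coact _ _ _ M) f >].

Lemma colinear_submod : submod_closed colinear.
Proof.
split=> [|a f g /asboolP hf /asboolP hg]; apply/asboolP => h.
  rewrite /= linear0 /tsum /tsumseq big1 // => p _.
  by rewrite (lin0 (f := fun z => z ⊗ p.2)).
rewrite /= linearP hf hg -tsumZ /tsum /tsumseq -big_split; apply: eq_bigr => p _ /=.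
by rewrite (tens_bilin _ _).1.
Qed.

HB.instance Definition _ := GRing.isSubmodClosed.Build k {linear H -> M} colinear colinear_submod.

Record hat_type := Hat { hat_val :> {linear H -> M}; hat_valP : hat_val \in colinear }.
HB.instance Definition _ := [isSub for hat_val].
HB.instance Definition _ := [Choice of hat_type by <:].
HB.instance Definition _ := [SubChoice_isSubLmodule of hat_type by <:].

Lemma hatP (f g : hat_type) : f =1 g -> f = g.
Proof. by move=> /linP /val_inj. Qed.
Lemma hat_coact (f : hat_type) : comodule_map comul (@coact _ _ _ M) f.
Proof. by apply/asboolP; exact: hat_valP. Qed.
Lemma hat_linE a (f g : hat_type) x : (a *: f + g) x = a *: f x + g x.
Proof. by []. Qed.

Lemma sw_comul_conj U (F : H -> H -> U) a x c : bilin F ->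
  \sw_(y1, y2 <- comul (antipode a * x * S^[- (2 * i)] c)) F y1 y2 =
  \sw_(c1, c2 <- comul c) \sw_(a1, a2 <- comul a) \sw_(x1, x2 <- comul x) 
    F (antipode a2 * x1 * S^[- (2 * i)] c1) (antipode a1 * x2 * S^[- (2 * i)] c2).
Proof.
have hT := hopf_end_antipow H (- i); rewrite mulrN in hT.
move=> [F1 F2].
have F1' w : lin (fun a => F a w) := F1 w.
have F2' w : lin (fun a => F w a) := F2 w.
rewrite sw_comulM // exch_tsum (sw_hopf_end c hT) //; apply: eq_tsum => c1 c2.
by rewrite sw_comulM // sw_comul_antipode.
Qed.

Lemma hat_act_subproof h (f : hat_type) : yd_conj (- (2 * i)) h f \in colinear.
Proof.
have hT := hopf_end_antipow H (- i); rewrite mulrN in hT.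
have [_ T1 TM _ _] := hT.
pose T := @antipow k H (- (2 * i)).
apply/asboolP => x; rewrite /= (tsum_f (f := coact)) //.
pose Q (c r b u w : H) := \sw_(x1, x2 <- comul x)
  hact r (f (antipode b * x1 * T c)) ⊗ (u * x2 * T w).
transitivity (\sw_(h1, h' <- comul h) \sw_(h2, h3 <- comul h') Q h1 h2 h3 1 1); last first.
  under [RHS]eq_tsum => x1 x2.
    rewrite (tsum_f (f := fun z => z ⊗ x2)) //.
    under eq_tsum => h1 h' do rewrite (tsum_f (f := fun z => z ⊗ x2)) //.
    over.
  rewrite exch_tsum; apply: eq_tsum => h1 h'.
  rewrite exch_tsum; apply: eq_tsum => h2 h3.
  by apply: eq_tsum => x1 x2; rewrite /T T1 mulr1 mul1r.
rewrite -sw_conj7; try by move=> *; rewrite /Q /T.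
apply: eq_tsum => h1 h'; rewrite exch_tsum (tsum_f (f := coact)) //.
apply: eq_tsum => h2 h3; rewrite coact_act hat_coact.
under eq_tsum => p q.
  under eq_tsum => r s.
    rewrite tsum_tsum //.
    under eq_tsum => y1 y2 do rewrite tsumE // antipow_exp_mod.
    rewrite sw_comul_conj //.
    over.
  rewrite exch_tsum.
  over.
rewrite exch_tsum; apply: eq_tsum => c1 c2.
apply: eq_tsum => p q; apply: eq_tsum => r s; apply: eq_tsum => a1 a2.
by apply: eq_tsum => x1 x2; rewrite /T TM !mulrA.
Qed.
Definition hat_act h (f : hat_type) : hat_type := Hat (hat_act_subproof h f).

Lemma hat_act_bilin : bilin hat_act.
Proof.
split=> [f a g h|h a f g]; apply: hatP => x; rewrite hat_linE /=.
  by rewrite linearP /= [LHS]tsum_linear.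
have l : lin (fun f : {linear H -> M} => \sw_(h1, h' <- comul h) \sw_(h2, h3 <- comul h')
  hact h2 (f (antipode h3 * x * S^[- (2 * i)] h1))) by [].
exact: (l a f g).
Qed.
Lemma lin_hat_val : lin hat_val. Proof. by []. Qed.
Ltac lin_atom ::= first [exact: counit_lin | exact: tmul_bilin | exact: hact_bilin | exact: lin_hat_val].
Lemma hat_act1 f : hat_act 1 f = f.
Proof.
have := hopf_end_antipow H (- i); rewrite mulrN => -[_ T1 _ _ _].
apply: hatP => x; rewrite /= comul1 tsumE // comul1 tsumE //.
by rewrite hact1 T1 antipode1 mul1r mulr1.
Qed.
Lemma hat_actM g h f : hat_act (g * h) f = hat_act g (hat_act h f).
Proof.
have := hopf_end_antipow H (- i); rewrite mulrN => -[_ _ TM _ _].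
apply: hatP => x; rewrite /= sw_comulM //; apply: eq_tsum => a b.
under eq_tsum => c d do rewrite sw_comulM //.
rewrite exch_tsum; apply: eq_tsum => g2 g3.
rewrite (tsum_f (f := hact g2)) //; apply: eq_tsum => c d.
rewrite (tsum_f (f := hact g2)) //; apply: eq_tsum => h2 h3.
by rewrite hactM antipodeM TM !mulrA.
Qed.
Definition hat_hmodule : hmodule H := HModule hat_act_bilin hat_act1 hat_actM.

Lemma hat_contra_hom_subproof (t : {linear H -> hat_hmodule}) :
  linear (fun h : H => \sw_(a, b <- comul h) hat_val (t a) b).
Proof. by lin. Qed.

Lemma hat_contra_in_subproof (t : {linear H -> hat_hmodule}) :
  mklin (hat_contra_hom_subproof t) \in colinear.
Proof.
apply/asboolP => h; rewrite /= (tsum_f (f := coact)) //.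
under eq_tsum => a b do rewrite hat_coact.
under [RHS]eq_tsum => a b do rewrite (tsum_f (f := fun z => z ⊗ b)) //.
by rewrite [RHS](sw_assoc (F := fun a b c => hat_val (t a) b ⊗ c)).
Qed.

Lemma hat_contra_subproof : linear (fun t : {linear H -> hat_hmodule} =>
  Hat (hat_contra_in_subproof t) : hat_hmodule).
Proof.
move=> a t u; apply: hatP => h; rewrite [RHS]hat_linE /=.
by rewrite /tsum /tsumseq scaler_sumr -big_split.
Qed.
Definition hat_contra : {linear {linear H -> hat_hmodule} -> hat_hmodule} :=
  mklin hat_contra_subproof.

Lemma hat_contraA (f : {linear tensor H H -> hat_hmodule}) :
    hat_contra (hat_contra \o tcurry f) = hat_contra (f \o comul).
Proof.
apply: hatP => h /=; symmetry.
under eq_tsum => a b do rewrite (tsum_lift (f := fun t => hat_val (f t) b)) //.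
by rewrite (sw_assoc (F := fun c d b => hat_val (f (c ⊗ d)) b)).
Qed.

Lemma hat_contra_counit (y : hat_hmodule) : hat_contra (counit_scale H y) = y.
Proof. by apply: hatP => h /=; rewrite (sw_counitl (f := hat_val y)). Qed.

Lemma hat_contra_act h (t : {linear H -> hat_hmodule}) :
  hact h (hat_contra t) = hat_contra (yd_conj (2 - 2 * (i + 1)) h t).
Proof.
rewrite exp_ctr; apply: hatP => x /=.
transitivity (\sw_(x1, x2 <- comul x) \sw_(h1, h' <- comul h) \sw_(h2, h3 <- comul h')
    \sw_(p, q <- comul h2) \sw_(r, s <- comul q) 
     hact r (hat_val (t (antipode h3 * x1 * S^[- (2 * i)] h1)) (antipode s * x2 * S^[- (2 * i)] p))); last first.
  apply: eq_tsum => x1 x2.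
  rewrite (tsum_f (f := fun f => hat_val f x2)) //; apply: eq_tsum => h1 h'.
  by rewrite (tsum_f (f := fun f => hat_val f x2)).
under [RHS]eq_tsum => x1 x2.
  rewrite -(sw_split5 (K := fun c d e a b => hact e (hat_val (t (antipode b * x1 * S^[- (2 * i)] c)) (antipode a * x2 * S^[- (2 * i)] d)))) //.
  over.
rewrite exch_tsum; apply: eq_tsum => h1 h'.
rewrite exch_tsum; apply: eq_tsum => h2 h3.
rewrite sw_comul_conj // (tsum_f (f := hact h2)) //.
rewrite exch_tsum; apply: eq_tsum => c d.
rewrite (tsum_f (f := hact h2)) // exch_tsum; apply: eq_tsum => a b.
by rewrite (tsum_f (f := hact h2)).
Qed.

Definition hat : YDctr H (i + 1) :=
  YDCtr hat_contraA hat_contra_counit hat_contra_act.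
End Hat.

Arguments colinear {i} M _.
Section HatMap.
Variables (i : int) (M N : YDmod H (i - 1)) (f : YDmod_hom M N).

Lemma hat_map_in_subproof (g : hat M) : (f \o hat_val g : {linear H -> N}) \in colinear N.
Proof.
apply/asboolP => h /=; rewrite ydmod_hom_coact hat_coact tsum_tsum //.
by apply: eq_tsum => a b; rewrite tsumE.
Qed.
Lemma hat_map_subproof : linear (fun g : hat M => Hat (hat_map_in_subproof g) : hat N).
Proof. by move=> a g h; apply: hatP => x; rewrite [RHS]hat_linE /= -linearP. Qed.
Definition hat_map_fun : {linear hat M -> hat N} := mklin hat_map_subproof.
Lemma hat_map_act h g : hat_map_fun (hact h g) = hact h (hat_map_fun g).
Proof.
apply: hatP => x /=; rewrite (tsum_f (f := f)) //; apply: eq_tsum => a b.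
by rewrite (tsum_f (f := f)) //; apply: eq_tsum => c d; rewrite ydmod_hom_act.
Qed.
Lemma hat_map_contra (t : {linear H -> hat M}) :
  hat_map_fun (contra (hat M) t) = contra (hat N) (hat_map_fun \o t).
Proof. by apply: hatP => x /=; rewrite (tsum_f (f := f)). Qed.
Definition hat_map : YDctr_hom (hat M) (hat N) := YDCtrHom hat_map_act hat_map_contra.
End HatMap.

Section Precomp.
Ltac lin_atom ::= first [exact: counit_lin | exact: tmul_bilin | exact: hact_bilin | exact: lin_hat_val].
Variables (i : int) (M : YDmod H (i - 1)).
Let dom := twist_ctr i (hat M).
Let cod := hat (twist_mod i M).

Lemma precomp_in_subproof (f : dom) :
  (hat_val f \o S^[2 * i] : {linear H -> twist_mod i M}) \in colinear (twist_mod i M).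
Proof.
apply/asboolP => h /=; rewrite hat_coact tsum_tsum //.
rewrite (sw_hopf_end h (hopf_end_antipow H i)) //.
by apply: eq_tsum => a b; rewrite tsumE // antipowK.
Qed.
Lemma precomp_subproof : linear (fun f : dom => Hat (precomp_in_subproof f) : cod).
Proof. by move=> a f g; apply: hatP => x. Qed.
Definition precomp_fun : {linear dom -> cod} := mklin precomp_subproof.
Lemma precomp_act h f : precomp_fun (hact h f) = hact h (precomp_fun f).
Proof.
have [_ _ TM _ _] := hopf_end_antipow H i.
apply: hatP => x /=; rewrite (sw_hopf_end h (hopf_end_antipow H i)) //; apply: eq_tsum => a b.
rewrite (sw_hopf_end b (hopf_end_antipow H i)) //; apply: eq_tsum => c d.
by rewrite /twist_act !TM antipowK antipowNK antipow_antipode.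
Qed.
Lemma precomp_contra (t : {linear H -> dom}) :
  precomp_fun (contra dom t) = contra cod (precomp_fun \o t).
Proof.
apply: hatP => x /=; rewrite (sw_hopf_end x (hopf_end_antipow H i)) //.
by apply: eq_tsum => a b; rewrite antipowK.
Qed.
Definition precomp : YDctr_hom dom cod := YDCtrHom precomp_act precomp_contra.
End Precomp.
End Diagram.

Ltac lin_atom ::= first [exact: counit_lin | exact: tmul_bilin
  | exact: hact_bilin | exact: lin_hat_val].

(* Main.v *)
Require Import Defs.
From mathcomp Require Import all_boot all_algebra.
From mathcomp Require Import boolp.
Set Implicit Arguments.
Unset Strict Implicit.
Unset Printing Implicit Defensive.
Import GRing.Theory.
Local Open Scope ring_scope.

(** On [f] in the hat of [M], both composites evaluate at [x] to
    [S^{2i}(x^2) f(x^1)]: one by colinearity of [f], the other because [S(x^3) x^4]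
    cancels in [x^2 f(S(x^3) x^4 S^{-2i}(x^1))].  The map [sigma_M] has the inverse
    [m |-> S^{-1}(m_1) m_0], precomposition with [S^{2i}] has the inverse
    precomposition with [S^{-2i}], and [sigma] on the hat of [M] is then an
    isomorphism by two-out-of-three. *)

Section AntipodeInverse.
Variables (k : fieldType) (H : hopfAlgebra k).
Implicit Types (g h : H) (U : lmodType k).

Lemma antipowN1K : cancel (S^[-1] : H -> H) antipode.
Proof. exact: antipodeVK. Qed.

Lemma antipodeKN1 : cancel antipode (S^[-1] : H -> H).
Proof. exact: antipodeK. Qed.

Lemma antipowN1M g h : S^[-1] (g * h) = S^[-1] h * S^[-1] g.
Proof. by apply: (can_inj antipodeKN1); rewrite antipodeM !antipowN1K. Qed.

Lemma antipowN1_1 : S^[-1] 1 = 1 :> H.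
Proof. by rewrite -[X in S^[-1] X]antipode1 antipodeKN1. Qed.

Lemma sw_comul_antipowN1 U (F : H -> H -> U) h : bilin F ->
  \sw_(a, b <- comul (S^[-1] h)) F a b =
  \sw_(a, b <- comul h) F (S^[-1] b) (S^[-1] a).
Proof.
move=> [F1 F2].
have F1' w : lin (fun a => F a w) := F1 w.
have F2' w : lin (fun a => F w a) := F2 w.
rewrite -[in RHS](antipowN1K h) sw_comul_antipode //.
by apply: eq_tsum => a b; rewrite !antipodeKN1.
Qed.

Lemma sw_antipowN1l U (f : H -> U) h : lin f ->
  \sw_(a, b <- comul h) f (S^[-1] b * a) = counit h *: f 1.
Proof.
move=> hf; rewrite -[in RHS]antipowN1_1.
rewrite -(sw_antipodel (f := fun z => f (S^[-1] z))); last exact: (lin_comp hf).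
by apply: eq_tsum => a b; rewrite antipowN1M antipodeKN1.
Qed.

Lemma sw_antipowN1r U (f : H -> U) h : lin f ->
  \sw_(a, b <- comul h) f (b * S^[-1] a) = counit h *: f 1.
Proof.
move=> hf; rewrite -[in RHS]antipowN1_1.
rewrite -(sw_antipoder (f := fun z => f (S^[-1] z))); last exact: (lin_comp hf).
by apply: eq_tsum => a b; rewrite antipowN1M antipodeKN1.
Qed.

End AntipodeInverse.

Section Inverses.
Variables (k : fieldType) (H : hopfAlgebra k).

Lemma ydmod_hom_inverse j (M N : YDmod H j) (f : YDmod_hom M N) (g : N -> M) :
  cancel f g -> cancel g f -> exists g' : YDmod_hom N M, g' =1 g.
Proof.
move=> fK gK.
have gl : linear g by move=> a x y; apply: (can_inj fK); rewrite linearP !gK.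
have gact h m : mklin gl (hact h m) = hact h (mklin gl m).
  by apply: (can_inj fK); rewrite ydmod_hom_act /= !gK.
have gcoact : comodule_map (@coact _ _ _ N) (@coact _ _ _ M) (mklin gl).
  move=> n; rewrite -{2}[n]gK ydmod_hom_coact tsum_tsum //.
  rewrite -[LHS]tsum_tens; apply: eq_tsum => a b.
  by rewrite tsumE // /= fK.
by exists (YDModHom gact gcoact).
Qed.

Lemma ydctr_isoP j (M N : YDctr H j) (f : YDctr_hom M N) :
  ydctr_iso f <-> bijective f.
Proof.
split=> [[g [fK gK]]|[g fK gK]]; first by exists g.
have gl : linear g by move=> a x y; apply: (can_inj fK); rewrite linearP !gK.
have gact h m : mklin gl (hact h m) = hact h (mklin gl m).
  by apply: (can_inj fK); rewrite ydctr_hom_act /= !gK.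
have gcontra (t : {linear H -> N}) :
    mklin gl (Defs.contra N t) = Defs.contra M (mklin gl \o t).
  apply: (can_inj fK); rewrite ydctr_hom_contra /= gK; congr (Defs.contra N _).
  by apply: linP => x /=; rewrite gK.
by exists (YDCtrHom gact gcontra).
Qed.

End Inverses.

Section SigmaInverse.
Variables (k : fieldType) (H : hopfAlgebra k) (i : int) (M : YDmod H (i - 1)).

Definition sigma_mod_inv (m : M) : M := \sw_(m0, m1 <- coact m) hact (S^[-1] m1) m0.

Lemma sigma_modK : cancel (sigma_mod M) sigma_mod_inv.
Proof.
have [_ T1 TM _ _] := hopf_end_antipow H i.
move=> m.
have -> : sigma_mod_inv (sigma_mod M m) =
    \sw_(a, b <- @coact _ _ _ (twist_mod i M) (sigma_mod M m))
      (hact (S^[-1] (S^[2 * i] b)) (a : M) : M).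
  by rewrite [RHS]sw_twist_coact //; apply: eq_tsum => a b; rewrite antipowNK.
rewrite ydmod_hom_coact tsum_tsum //.
under eq_tsum => a b.
  rewrite tsumE // (tsum_f (f := hact _)) //.
  under eq_tsum => c d.
    rewrite -hactM -(antipow_add (-1)) [-1 + _]addrC antipow_add -TM.
    over.
  over.
rewrite (sw_coactA (F := fun c d b => hact (S^[2 * i] (S^[-1] b * d)) c)) //.
under eq_tsum => m0 m1 do
  rewrite (sw_antipowN1l (f := fun z => hact (S^[2 * i] z) m0)) // T1 hact1.
exact: coact_counit.
Qed.

Lemma sigma_mod_invK : cancel sigma_mod_inv (sigma_mod M).
Proof.
have [_ T1 TM _ _] := hopf_end_antipow H i.
move=> m; rewrite /sigma_mod_inv (tsum_f (f := sigma_mod M)) //=.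
under eq_tsum => m0 m1.
  rewrite coact_act tsum_tsum // sw_comul_antipowN1 //.
  under eq_tsum => t x4.
    rewrite tsum_tsum // sw_comul_antipowN1 //.
    under eq_tsum => x2 x3.
      rewrite tsum_tsum //.
      under eq_tsum => a b do
        rewrite tsumE // antipow_exp_mod antipowN1K 2!TM antipowNK -TM.
      over.
    rewrite exch_tsum.
    over.
  rewrite exch_tsum.
  over.
rewrite (sw_coactA (F := fun a b m1 => \sw_(t, x4 <- comul m1) \sw_(x2, x3 <- comul t)
  hact (S^[2 * i] (S^[-1] x2 * b) * x4) (hact (S^[-1] x3) a))) //.
rewrite -[RHS](coact_counit m); apply: eq_tsum => m0 m1.
under eq_tsum => b u do rewrite (sw_assoc (F := fun x2 x3 x4 =>
  hact (S^[2 * i] (S^[-1] x2 * b) * x4) (hact (S^[-1] x3) m0))) //.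
rewrite -(sw_assoc (F := fun b x2 v => \sw_(x3, x4 <- comul v)
  hact (S^[2 * i] (S^[-1] x2 * b) * x4) (hact (S^[-1] x3) m0))) //.
under eq_tsum => w v do rewrite (sw_antipowN1l (f := fun z => \sw_(x3, x4 <- comul v)
  hact (S^[2 * i] z * x4) (hact (S^[-1] x3) m0))) // T1.
rewrite (sw_counitl (f := fun v => \sw_(x3, x4 <- comul v)
  hact (1 * x4) (hact (S^[-1] x3) m0))) //.
under eq_tsum => x3 x4 do rewrite mul1r -hactM.
by rewrite (sw_antipowN1r (f := fun z => hact z m0)) // hact1.
Qed.

End SigmaInverse.

Lemma hat_map_bij (k : fieldType) (H : hopfAlgebra k) (i : int)
    (M N : YDmod H (i - 1)) (f : YDmod_hom M N) :
  bijective f -> bijective (hat_map f).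
Proof.
move=> [g fK gK]; have [g' eg] := ydmod_hom_inverse fK gK.
by exists (hat_map g') => u; apply: hatP => x /=; rewrite eg.
Qed.

Section PrecompInverse.
Variables (k : fieldType) (H : hopfAlgebra k) (i : int) (M : YDmod H (i - 1)).

Lemma precomp_inv_in (f : hat (twist_mod i M)) :
  (hat_val f \o S^[- (2 * i)] : {linear H -> M}) \in colinear (M := M).
Proof.
have hT := hopf_end_antipow H (- i); rewrite mulrN in hT.
apply/asboolP => h /=; set m := f _.
have -> : coact (m : M) =
    \sw_(a, b <- @coact _ _ _ (twist_mod i M) m) ((a : M) ⊗ S^[2 * i] b).
  rewrite [RHS]sw_twist_coact // -[LHS]tsum_tens.
  by apply: eq_tsum => a b; rewrite antipowNK.
rewrite hat_coact tsum_tsum // (sw_hopf_end h hT) //.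
by apply: eq_tsum => a b; rewrite tsumE // antipowNK.
Qed.

Lemma precomp_bij : bijective (precomp M).
Proof.
exists (fun f => Hat (precomp_inv_in f)) => f; apply: hatP => x /=.
  by rewrite antipowNK.
by rewrite antipowK.
Qed.

End PrecompInverse.

Lemma hat_sigma_mod (k : fieldType) (H : hopfAlgebra k) (i : int)
    (M : YDmod H (i - 1)) :
  hat_map (sigma_mod M) = ydctr_comp (precomp M) (sigma_ctr (hat M)).
Proof.
apply: ydctr_hom_ext => f; apply: hatP => x /=.
rewrite (hat_coact f) tsum_tsum //.
rewrite (sw_assoc (F := fun h1 h' b => \sw_(h2, h3 <- comul h')
  hact h2 (f (antipode h3 * b * S^[- (2 * i)] h1)))) //.
rewrite (sw_hopf_end x (hopf_end_antipow H i)) //; apply: eq_tsum => a b.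
rewrite tsumE // antipowK.
rewrite (sw_assoc (F := fun h2 h3 b => hact h2 (f (antipode h3 * b * a)))) //.
under eq_tsum => h2 t do rewrite (sw_antipodel (f := fun z => hact h2 (f (z * a)))) // mul1r.
by rewrite (sw_counitr (f := fun h2 => hact h2 (f a))).
Qed.

Theorem mainTheorem20 (k : fieldType) (char_k : [pchar k] =i pred0)
    (H : hopfAlgebra k) (i : int) (M : YDmod H (i - 1)) :
  [/\ ydctr_iso (hat_map (sigma_mod M)),
      ydctr_iso (sigma_ctr (hat M)),
      ydctr_iso (precomp M) &
      hat_map (sigma_mod M) = ydctr_comp (precomp M) (sigma_ctr (hat M))].
Proof.
have e := hat_sigma_mod M.
have p_bij := precomp_bij M.
have s_bij : bijective (hat_map (sigma_mod M)).
  by apply: hat_map_bij; exists (@sigma_mod_inv k H i M);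
    [apply: sigma_modK | apply: sigma_mod_invK].
split=> //; apply/ydctr_isoP => //.
have [q pK qK] := p_bij.
apply: (eq_bij (bij_comp (Bijective qK pK) s_bij)) => f.
by rewrite -[LHS]/(q (hat_map (sigma_mod M) f)) e [LHS]pK.
Qed.
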